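(* Let $X$ and $Y$ be two non-negative random variables with pdfs $f$ and $g$, respectively, let $n$ be a positive integer, and let $\alpha>0$, $\alpha\neq1$. If $X\leq_{disp}Y$, then $S_{\alpha}(\boldsymbol X_{\rm MRSSU})\leq S_{\alpha}(\boldsymbol Y_{\rm MRSSU})$.
   Context: $X$ and $Y$ are non-negative, absolutely continuous, with pdfs $f,g$ and cdfs $F,G$; $F^{-1},G^{-1}$ are the right-continuous inverses. $X\leq_{disp}Y$ (dispersive order) means $f(F^{-1}(u))\geq g(G^{-1}(u))$ for all $u\in(0,1)$. $\boldsymbol X_{\rm MRSSU}$ (maximum ranked set sampling with unequal samples, size $n$) is a vector of $n$ independent random variables whose $i$-th component is the maximum of a simple random sample of size $i$ from $X$. Its Tsallis entropy of order $\alpha>0$, $\alpha\ne1$, is $$S_{\alpha}(\boldsymbol X_{\rm MRSSU})=\frac{1}{1-\alpha}\left(\prod_{i=1}^{n}\left[\int_{0}^{1}i^{\alpha}u^{\alpha(i-1)}f^{\alpha-1}(F^{-1}(u))\,du\right]-1\right),$$ where $f^{\alpha-1}(F^{-1}(u))=[f(F^{-1}(u))]^{\alpha-1}$; $S_{\alpha}(\boldsymbol Y_{\rm MRSSU})$ is defined in the same way with $g,G$ (same $n$). *)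

(* Defs.v *)
From HB Require Import structures.
From mathcomp Require Import all_boot all_order all_algebra.
From mathcomp Require Import all_classical all_reals all_analysis.
Set Implicit Arguments.
Unset Strict Implicit.
Unset Printing Implicit Defensive.
Import Order.TTheory GRing.Theory Num.Theory.
Import numFieldNormedType.Exports.
Local Open Scope classical_set_scope.
Local Open Scope ring_scope.

Definition is_pdf (d : measure_display) (T : measurableType d) (R : realType)
    (P : probability T R) (X : {RV P >-> R}) (f : R -> R) : Prop :=
  [/\ measurable_fun [set: R] f,
      (forall x, 0 <= f x) &
      (forall A : set R, measurable A ->
         distribution P X A = (\int[lebesgue_measure]_(x in A) (f x)%:E)%E)].

(* The right-continuous inverse sup {x | F x <= u} = inf {x | u < F x}; only
   its values at 0 < u < 1, where the supremum is attained, are used. *)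
Definition cdf_inv (d : measure_display) (T : measurableType d) (R : realType)
    (P : probability T R) (X : {RV P >-> R}) (u : R) : R :=
  sup [set x : R | (cdf X x <= u%:E)%E].

Definition disp_le (R : realType)
    (d1 : measure_display) (T1 : measurableType d1) (P : probability T1 R)
    (X : {RV P >-> R}) (f : R -> R)
    (d2 : measure_display) (T2 : measurableType d2) (Q : probability T2 R)
    (Y : {RV Q >-> R}) (g : R -> R) : Prop :=
  forall u : R, 0 < u < 1 -> g (cdf_inv Y u) <= f (cdf_inv X u).

(* Extended-real valued because the integrals may diverge. When alpha < 1,
   [powR] sets 0 `^ (alpha - 1) = 0; this does not affect the integral since f
   vanishes at F^-1(u) only for u in a Lebesgue-null set. *)
Definition tsallis_mrssu (d : measure_display) (T : measurableType d)
    (R : realType) (P : probability T R) (X : {RV P >-> R}) (f : R -> R)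
    (n : nat) (alpha : R) : \bar R :=
  (((1 - alpha)^-1)%:E *
   (\prod_(1 <= i < n.+1)
      \int[lebesgue_measure]_(u in `]0%R, 1%R[)
        (i%:R `^ alpha * u `^ (alpha * (i%:R - 1))
         * f (cdf_inv X u) `^ (alpha - 1))%:E
    - 1))%E.

(* Main.v *)
(* For alpha > 1 the dispersive order bounds each integrand for Y by the one for
   X, and the factor 1 / (1 - alpha) < 0 reverses the resulting inequality.
   For alpha < 1 the integrands compare the other way wherever g(G^-1(u)) > 0,
   which holds for almost every u: if U is uniform on ]0, 1[, then G^-1(U) has
   the law of Y, and Y avoids the zeros of its density almost surely. *)
Require Import Defs.
From HB Require Import structures.
From mathcomp Require Import all_boot all_order all_algebra.
From mathcomp Require Import all_classical all_reals all_analysis.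
From mathcomp Require Import unstable measurable_realfun.
Import Order.TTheory GRing.Theory Num.Theory.
Import numFieldNormedType.Exports.
Local Open Scope classical_set_scope.
Local Open Scope ring_scope.

Set Implicit Arguments.
Unset Strict Implicit.

(** Monotonicity makes the preimage of a ray [[r, +oo[] inside the interval [D] an interval again,
    and these rays generate the Borel sets. *)
Lemma nondecreasing_in_measurable (R : realType) (D : set R) (h : R -> R) :
  is_interval D -> {in D &, nondecreasing_fun h} -> measurable_fun D h.
Proof.
move=> iD h_nd mD.
apply: (measurability (@RGenCInfty.G R)) => //.
  exact: RGenCInfty.measurableE.
move=> /= _ [_ [r ->] <-]; apply: is_interval_measurable.
move=> s t [Ds hs] [Dt _] u /andP[su ut].
have Du : D u by apply: (iD s t) => //; rewrite su ut.
split=> //; move: hs; rewrite /= !in_itv/= !andbT => /le_trans; apply.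
by apply: h_nd => //; rewrite inE.
Qed.

Lemma lee_prod (R : realDomainType) (I : Type) (s : seq I) (p : pred I)
    (a b : I -> \bar R) :
  (forall i, p i -> 0 <= a i)%E -> (forall i, p i -> a i <= b i)%E ->
  (\prod_(i <- s | p i) a i <= \prod_(i <- s | p i) b i)%E.
Proof.
move=> a0 ab.
(* Nonnegativity of the smaller product is carried through the induction, since multiplying
   inequalities requires it. *)
suff /andP[] : (0 <= \prod_(i <- s | p i) a i <= \prod_(i <- s | p i) b i)%E
  by [].
apply: (big_ind2 (fun x y => 0 <= x <= y)%E).
- by rewrite lee01 lexx.
- move=> x1 x2 y1 y2 /andP[x0 x12] /andP[y0 y12].
  by rewrite mule_ge0//= lee_pmul.
- by move=> i pi; rewrite a0// ab.
Qed.

Lemma lee_nmul2l (R : realDomainType) (c : R) (x y : \bar R) :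
  c <= 0 -> (x <= y)%E -> (c%:E * y <= c%:E * x)%E.
Proof.
move=> c0 xy; rewrite -[c]opprK EFinN !mulNe leeN2.
by apply: lee_wpmul2l; rewrite // lee_fin oppr_ge0.
Qed.

(** Taking inverses reduces this to a nonnegative exponent. Strict positivity of [x] matters: for
    [r < 0] the convention gives 0 to the power [r] the value 0, which breaks antitonicity at 0. *)
Lemma ler_powR_neg (R : realType) (r x y : R) :
  r <= 0 -> 0 < x -> x <= y -> y `^ r <= x `^ r.
Proof.
move=> r0 x0 xy; rewrite -[r]opprK !(powRN _ (- r)) lef_pV2 ?posrE ?powR_gt0//.
  apply: ge0_ler_powR; rewrite ?nnegrE ?oppr_ge0 ?(ltW x0)//.
  exact: le_trans (ltW x0) xy.
exact: lt_le_trans xy.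
Qed.

Section quantile.
Context (d : measure_display) (T : measurableType d) (R : realType).
Context (P : probability T R) (X : {RV P >-> R}).

Let G (x : R) : R := fine (cdf X x).

Let GE x : cdf X x = (G x)%:E.
Proof. by rewrite fineK// fin_num_measure. Qed.

Let cdf_invE u : cdf_inv X u = sup [set x | G x <= u].
Proof. by congr sup; apply/seteqP; split=> x /=; rewrite GE lee_fin. Qed.

Let G_nd : nondecreasing_fun G.
Proof. by move=> x y xy; rewrite -lee_fin -!GE cdf_nondecreasing. Qed.

Let G_lt x u y : G x <= u -> u < G y -> x <= y.
Proof.
move=> xu uy; rewrite leNgt; apply/negP => /ltW/G_nd yx.
by have := le_lt_trans (le_trans yx xu) uy; rewrite ltxx.
Qed.

(** Together with the upper bound that follows, this makes the [sup] in [cdf_inv] a genuine supremum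
    rather than a default value. The two facts come from the limits of the cdf at -oo and +oo. *)
Lemma cdf_sublevel_nonempty u : 0 < u -> [set x | G x <= u] !=set0.
Proof.
move=> u0; have /cvgr_lt/(_ u u0) : G @ -oo%R --> (0 : R)
  by exact/fine_cvg/cvg_cdfNy0.
by move/filter_ex => [x xu]; exists x; exact: ltW.
Qed.

Lemma cdf_sublevel_has_ubound u : u < 1 -> has_ubound [set x | G x <= u].
Proof.
move=> u1; have /cvgr_gt/(_ u u1) : G @ +oo%R --> (1 : R)
  by exact/fine_cvg/cvg_cdfy1.
by move/filter_ex => [y uy]; exists y => x /= xu; exact: G_lt uy.
Qed.

Lemma cdf_inv_le u x : 0 < u -> (u%:E < cdf X x)%E -> cdf_inv X u <= x.
Proof.
rewrite GE lte_fin cdf_invE => u0 ux.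
by apply: ge_sup => [|y /= yu]; [exact: cdf_sublevel_nonempty|exact: G_lt ux].
Qed.

(** Strictness comes from right-continuity: the cdf stays below [u] slightly to the right of [x], so
    the sublevel set contains a point beyond [x]. *)
Lemma cdf_inv_gt u x : u < 1 -> (cdf X x < u%:E)%E -> x < cdf_inv X u.
Proof.
rewrite GE lte_fin cdf_invE => u1 xu.
have : G y @[y --> x^'+] --> G x.
  by apply: fine_cvg; rewrite -GE; exact: cdf_right_continuous.
move=> /cvgr_lt/(_ u xu) Gu.
have [y [yu xy]] : exists y, G y < u /\ x < y.
  by apply: (@filter_ex _ x^'+); apply: filterI => //; exact: nbhs_right_gt.
apply: (lt_le_trans xy); apply: ub_le_sup; first exact: cdf_sublevel_has_ubound.
exact: ltW.
Qed.

Lemma measurable_cdf_inv : measurable_fun (`]0, 1[ : set R) (cdf_inv X).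
Proof.
apply: nondecreasing_in_measurable; first exact: interval_is_interval.
move=> u v; rewrite !inE/= !in_itv/= => /andP[u0 u1] /andP[v0 v1] uv.
rewrite !cdf_invE; apply: ge_sup; first exact: cdf_sublevel_nonempty.
move=> x /= xu; apply: ub_le_sup; first exact: cdf_sublevel_has_ubound.
exact: le_trans xu uv.
Qed.

(** Pushing a measure forward takes a map measurable on the whole line, while [cdf_inv] is
    controlled only on the open unit interval. *)
Let cdf_inv01 : R -> R := cdf_inv X \_ `]0%R, 1%R[.

Let measurable_cdf_inv01 :
  measurable_fun [set: measurableTypeR R] (cdf_inv01 : _ -> measurableTypeR R).
Proof.
have m01 : measurable (`]0, 1[ : set R) by [].
exact: (measurable_restrictT (cdf_inv X) m01).1 measurable_cdf_inv.
Qed.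

(* {u | x < cdf_inv X u} and ]cdf X x, 1[ differ at most by the point cdf X x. *)
Lemma cdf_inv_uniform_gt (x : R) :
  (lebesgue_measure ([set u | x < cdf_inv X u]%R `&` `]0%R, 1%R[) =
   distribution P X `]x, +oo[)%E.
Proof.
have G0 : 0 <= G x by rewrite -lee_fin -GE cdf_ge0.
have G1 : G x <= 1 by rewrite -lee_fin -GE cdf_le1.
have -> : (distribution P X `]x, +oo[ = (1 - G x)%:E)%E.
  rewrite EFinB -GE -(cdf_ccdf_1 X x) addeAC subee ?add0e//.
  by rewrite GE.
have mS : measurable ([set u | x < cdf_inv X u] `&` `]0%R, 1%R[).
  rewrite setIC.
  have -> : [set u | x < cdf_inv X u] = cdf_inv X @^-1` `]x, +oo[.
    by apply/seteqP; split=> u; rewrite /= in_itv/= andbT.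
  by apply: measurable_cdf_inv.
apply/le_anti/andP; split.
  have <- : lebesgue_measure `[G x, 1[ = (1 - G x)%:E.
    rewrite lebesgue_measure_itv/= lte_fin; case: ltP => // ?.
    by rewrite (@le_anti _ _ 1 (G x)) ?subrr//; apply/andP.
  apply: le_measure; rewrite ?inE// => u [/= xu].
  rewrite !in_itv/= => /andP[u0 ->]; rewrite andbT leNgt; apply/negP => uG.
  by move: xu; rewrite ltNge cdf_inv_le// GE lte_fin.
have <- : lebesgue_measure `]G x, 1[ = (1 - G x)%:E.
  rewrite lebesgue_measure_itv/= lte_fin; case: ltP => // ?.
  by rewrite (@le_anti _ _ 1 (G x)) ?subrr//; apply/andP.
apply: le_measure; rewrite ?inE// => u /=.
rewrite !in_itv/= => /andP[Gu u1]; rewrite u1 (le_lt_trans G0 Gu); split=> //.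
by rewrite cdf_inv_gt// GE lte_fin.
Qed.

(** This is inverse transform sampling. The law of [cdf_inv X] under the uniform measure and the law
    of [X] agree on the rays []x, +oo[], which are stable under intersection and generate the Borel
    sets, so they agree everywhere. *)
Lemma cdf_inv_uniform (A : set R) : measurable A ->
  lebesgue_measure ([set u | A (cdf_inv X u)] `&` `]0%R, 1%R[) =
  distribution P X A.
Proof.
move=> mA.
have restrE B : cdf_inv01 @^-1` B `&` `]0%R, 1%R[ =
    [set u | B (cdf_inv X u)] `&` `]0%R, 1%R[.
  apply/seteqP; split=> u [/= Bu u01]; split => //; move: Bu;
    by rewrite /cdf_inv01 patchE mem_set.
pose unif : {measure set (measurableTypeR R) -> \bar R} :=
  mrestr lebesgue_measure (@measurable_itv R `]0%R, 1%R[).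
pose law : {measure set R -> \bar R} :=
  pushforward unif (cdf_inv01 : measurableTypeR R -> R).
pose dX : {measure set R -> \bar R} := distribution P X.
have law_ray x :
    law measurable_cdf_inv01 `]x, +oo[%classic = dX `]x, +oo[%classic.
  rewrite -[RHS]/(distribution P X _) -cdf_inv_uniform_gt /law /=.
  rewrite /pushforward/= /unif /mrestr restrE; congr (lebesgue_measure (_ `&` _)).
  by apply/seteqP; split=> u; rewrite /= in_itv/= andbT.
have law_eq : law measurable_cdf_inv01 A = dX A.
  (* The rays starting at [- k%:R] exhaust the line and have finite measure, as uniqueness of the
     extension requires. *)
  apply: (measure_unique (@RGenOInfty.G R)
    (fun k => `](- k%:R)%R, +oo[%classic)) => //.
  - exact: RGenOInfty.measurableE.
  - move=> _ _ [x ->] [y ->]; exists (Num.max x y).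
    by apply/seteqP; split=> z; rewrite /= !in_itv/= !andbT gt_max => /andP.
  - by move=> k; exists (- k%:R).
  - apply/seteqP; split=> // x _; exists (Num.bound x) => //=.
    by rewrite in_itv/= andbT ltrNl ltrNbound.
  - by move=> _ [x ->].
  - by move=> k; rewrite law_ray ltey_eq fin_num_measure.
by rewrite -[RHS]/(dX A) -law_eq -restrE.
Qed.

(** By [cdf_inv_uniform] the exceptional set has measure equal to the probability that [X] falls in
    the zero set of [f], which is the integral of [f] over that set. *)
Lemma pdf_cdf_inv_neq0 (f : R -> R) : is_pdf X f ->
  {ae lebesgue_measure, forall u, `]0, 1[%classic u -> f (cdf_inv X u) != 0}.
Proof.
move=> [mf _ f_pdf].
have mf0 : measurable (f @^-1` [set 0]).
  by rewrite -[X in measurable X]setTI; apply: mf.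
exists ([set u | (f @^-1` [set 0]) (cdf_inv X u)] `&` `]0%R, 1%R[); split.
- by rewrite setIC; apply: measurable_cdf_inv.
- by rewrite cdf_inv_uniform// f_pdf// integral0_eq// => x /= ->.
- by move=> u /= /not_implyP[u01 /negP]; rewrite negbK => /eqP.
Qed.

Lemma measurable_tsallis_integrand (f : R -> R) (i alpha : R) :
  measurable_fun [set: R] f ->
  measurable_fun (`]0, 1[ : set R) (fun u : R =>
    (i `^ alpha * u `^ (alpha * (i - 1)) * f (cdf_inv X u) `^ (alpha - 1))%:E).
Proof.
move=> mf; apply/measurable_EFinP; apply: measurable_funM.
  apply: measurable_funM; first exact: measurable_cst.
  by apply: measurable_funTS; exact: measurable_powR.
apply: (measurableT_comp (measurable_powR _)).
exact: (measurableT_comp mf measurable_cdf_inv).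
Qed.

End quantile.

Theorem theorem2p2 (R : realType)
    (d1 : measure_display) (T1 : measurableType d1) (P : probability T1 R)
    (d2 : measure_display) (T2 : measurableType d2) (Q : probability T2 R)
    (X : {RV P >-> R}) (Y : {RV Q >-> R}) (f g : R -> R)
    (n : nat) (alpha : R)
    (X_ge0 : {ae P, forall t, 0 <= X t}) (Y_ge0 : {ae Q, forall t, 0 <= Y t})
    (f_pdf : is_pdf X f) (g_pdf : is_pdf Y g)
    (n_gt0 : (0 < n)%N) (alpha_gt0 : 0 < alpha) (alpha_neq1 : alpha != 1)
    (XY : disp_le X f Y g) :
  (tsallis_mrssu X f n alpha <= tsallis_mrssu Y g n alpha)%E.
Proof.
have [mf f0 _] := f_pdf; have [mg g0 _] := g_pdf.
have integrand_ge0 (z : R) (i : nat) u :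
    (0 <= (i%:R `^ alpha * u `^ (alpha * (i%:R - 1)) * z `^ (alpha - 1))%:E)%E.
  by rewrite lee_fin !mulr_ge0// powR_ge0.
have /orP[alpha1|alpha1] : (alpha < 1) || (1 < alpha) by rewrite -neq_lt.
- apply: lee_wpmul2l; first by rewrite lee_fin invr_ge0 subr_ge0 ltW.
  apply: leeB (lexx _); apply: lee_prod => i _; first exact: integral_ge0.
  apply: ae_ge0_le_integral => //; [exact: measurable_tsallis_integrand..|].
  (* The comparison can fail only where [g] vanishes at [cdf_inv Y u]: elsewhere the dispersive
     order gives two positive densities, and the exponent [alpha - 1] is negative. *)
  apply: negligibleS (pdf_cdf_inv_neq0 g_pdf) => u /= le_fail g_neq0.
  apply: le_fail => u01; have gu0 := g_neq0 u01.
  rewrite lee_fin ler_wpM2l// ?mulr_ge0 ?powR_ge0//.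
  apply: ler_powR_neg; first by rewrite subr_le0 ltW.
    by rewrite lt_neqAle eq_sym gu0 g0.
  by apply: XY; move: u01; rewrite /= in_itv.
- apply: lee_nmul2l; first by rewrite invr_le0 subr_le0 ltW.
  apply: leeB (lexx _); apply: lee_prod => i _; first exact: integral_ge0.
  apply: ge0_le_integral => //; [exact: measurable_tsallis_integrand..|].
  move=> u u01; rewrite lee_fin ler_wpM2l// ?mulr_ge0 ?powR_ge0//.
  (* Here [alpha - 1] is positive, so zeros of the densities are harmless and the comparison holds
     at every [u]. *)
  apply: ge0_ler_powR; rewrite ?nnegrE ?subr_ge0 ?f0 ?g0 ?(ltW alpha1)//.
  by apply: XY; move: u01; rewrite /= in_itv.
Qed.
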